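(* Every $2$-graph $F$ with $\gcd(F)=1$ and $\chi(F)\geq3$ satisfies \begin{align*} \delta_1(\mathsf{Spa}_F)&=1-\frac{1}{\chi_{\mathrm{cr}}(F)},\\ \delta_1(\mathsf{Div}_F)&=1-\frac{1}{\chi(F)-1},\\ \delta_1(\mathsf{Cov}_F)&=1-\frac{1}{\chi(F)-1}. \end{align*}
   Context: A $2$-graph is a finite simple graph. $\chi(F)$ is the chromatic number. $\tau(F)$ is the relative size (size divided by $|V(F)|$) of a smallest colour class over all proper $\chi(F)$-colourings of $F$. For $\chi(F)\geq2$, $\chi_{\mathrm{cr}}(F)=\frac{\chi(F)-1}{1-\tau(F)}$. Let $\mathcal{D}(F)$ be the set of the integers $\big||\phi^{-1}(1)|-|\phi^{-1}(2)|\big|$ over all proper $\chi(F)$-colourings $\phi\colon V(F)\to\{1,\dots,\chi(F)\}$; $\gcd(F)$ is the greatest common divisor of $\mathcal{D}(F)\setminus\{0\}$, with $\gcd(F)=\infty$ if $\mathcal{D}(F)=\{0\}$. $\mathrm{Hom}(F;G)$ is the set of graph homomorphisms $V(F)\to V(G)$ (mapping edges to edges). A weighting $w\colon \mathrm{Hom}(F;G)\to\mathbb{R}$ is a perfect $\mathrm{Hom}(F)$-tiling of $G$ if $\sum_{\phi}w(\phi)|\phi^{-1}(v)|=1$ for every $v\in V(G)$; it is fractional (integral) if its values lie in $[0,1]$ (in $\mathbb{Z}$). $G$ is $\mathrm{Hom}(F)$-covered if for every $v\in V(G)$ there is $\phi\in\mathrm{Hom}(F;G)$ with $|\phi^{-1}(v)|=1$.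 $\mathsf{Spa}_F$, $\mathsf{Div}_F$, $\mathsf{Cov}_F$ denote the sets of graphs that have a perfect fractional $\mathrm{Hom}(F)$-tiling, have a perfect integral $\mathrm{Hom}(F)$-tiling, are $\mathrm{Hom}(F)$-covered, respectively. For $\mathsf{X}\in\{\mathsf{Spa}_F,\mathsf{Div}_F,\mathsf{Cov}_F\}$ the threshold $\delta_1(\mathsf{X})$ is the infimum over all $\delta\in[0,1]$ such that for all $\mu>0$ and all large enough $n$ divisible by $|V(F)|$, every $n$-vertex graph $G$ with minimum degree at least $(\delta+\mu)(n-1)$ belongs to $\mathsf{X}$. *)

(* Defs.v *)
From HB Require Import structures.
From mathcomp Require Import all_boot all_order all_algebra.
From mathcomp Require Import classical_sets reals.

Set Implicit Arguments.
Unset Strict Implicit.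
Unset Printing Implicit Defensive.

Import Order.TTheory GRing.Theory Num.Theory.
Local Open Scope ring_scope.

Record sgraph := SGraph {
  vertex :> finType;
  edge : rel vertex;
  edge_sym : symmetric edge;
  edge_irrefl : irreflexive edge
}.

Definition degree (G : sgraph) (v : G) : nat := #|[set u | edge v u]|.

(* The default #|G| only matters for the graph without vertices. *)
Definition min_degree (G : sgraph) : nat :=
  \big[minn/#|G|]_(v : G) degree v.

Section Colourings.
Variable F : sgraph.

Definition proper_colouring k (c : {ffun F -> 'I_k}) : bool :=
  [forall u, forall v, edge u v ==> (c u != c v)].

Lemma colourable_ex : exists k, [exists c : {ffun F -> 'I_k}, proper_colouring c].
Proof.
exists #|F|; apply/existsP; exists [ffun v => enum_rank v].
apply/forallP=> u; apply/forallP=> v; apply/implyP=> euv; rewrite !ffunE.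
by apply: contraTneq euv => /enum_rank_inj->; rewrite edge_irrefl.
Qed.

Definition chi : nat := ex_minn colourable_ex.

(* The colours are 0, ..., k - 1. *)
Definition class_size k (c : {ffun F -> 'I_k}) (i : nat) : nat :=
  #|[set v | c v == i :> nat]|.

(* Class sizes never exceed #|F|, so the default value is harmless. *)
Definition min_class_size : nat :=
  \big[minn/#|F|]_(c : {ffun F -> 'I_chi} | proper_colouring c)
    \big[minn/#|F|]_(i < chi) class_size c i.

Definition tau (R : realType) : R := min_class_size%:R / #|F|%:R.

Definition chi_cr (R : realType) : R := (chi%:R - 1) / (1 - tau R).

Definition class_diffs : seq nat :=
  [seq `|class_size c 0 - class_size c 1|%N
     | c : {ffun F -> 'I_chi} in [pred c | proper_colouring c]].

(* [None] stands for infinity. *)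
Definition gcd_graph : option nat :=
  if all (pred1 0%N) class_diffs then None
  else Some (\big[gcdn/0%N]_(d <- class_diffs | d != 0%N) d).

End Colourings.

Section Tilings.
Variable R : realType.
Variables F G : sgraph.

Definition is_hom (phi : {ffun F -> G}) : bool :=
  [forall u, forall v, edge u v ==> edge (phi u) (phi v)].

Definition graph_hom : finType := {phi : {ffun F -> G} | is_hom phi}.

Definition fibre_size (phi : graph_hom) (v : G) : nat :=
  #|[set u | val phi u == v]|.

Definition perfect_tiling (w : graph_hom -> R) : Prop :=
  forall v : G, \sum_(phi : graph_hom) w phi * (fibre_size phi v)%:R = 1.

Definition Spa : Prop :=
  exists2 w : graph_hom -> R, perfect_tiling w & forall phi, 0 <= w phi <= 1.

Definition Div : Prop :=
  exists2 w : graph_hom -> R, perfect_tiling w & forall phi, w phi \is a Num.int.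

Definition Cov : Prop :=
  forall v : G, exists phi : graph_hom, fibre_size phi v = 1%N.

End Tilings.

Arguments Cov : clear implicits.

Definition degree_forces (R : realType) (m : nat) (X : sgraph -> Prop)
    (delta : R) : Prop :=
  forall mu : R, 0 < mu -> exists n0 : nat, forall n : nat,
    (n0 <= n)%N -> (m %| n)%N ->
    forall G : sgraph, #|G| = n ->
      (delta + mu) * (n%:R - 1) <= (min_degree G)%:R -> X G.

(* The infimum is over a nonempty set bounded below: it always contains 1, as no
   graph on n >= 2 vertices has a vertex of degree more than n - 1. *)
Definition threshold (R : realType) (m : nat) (X : sgraph -> Prop) : R :=
  inf [set delta : R | 0 <= delta <= 1 /\ degree_forces m X delta]%classic.

(* Main.v *)
(* Let k = chi(F) and write n for the order of G. Above minimum degree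
   (1 - 1/(k-1)) n, any k-1 vertices of G have at least two common neighbours. So
   every vertex v lies in a k-clique, and v can be duplicated by another vertex
   completing the rest of the clique, which gives a homomorphism using v once.
   Swapping two colours on a k-clique and using gcd(F) = 1 shows that the
   differences e_x - e_y for edges xy lie in the lattice of integral tilings; G is
   connected, hence so does the all-one vector when |F| divides n.
   For fractional tilings, Farkas' lemma asks, for every y : V(G) -> R, for a
   homomorphism of y-weight at least |F| times the average of y. A clique chosen
   greedily by decreasing y provides one: if every vertex has at most D
   non-neighbours, then its i-th vertex beats all but (i-1) D vertices of G.
   The extremal graphs are the balanced complete (k-1)-partite graph, which F does
   not map to, and a complete k-partite graph with one part slightly smaller than
   tau(F) n. *)
Require Import Defs.
From mathcomp Require Import all_boot all_order all_algebra perm.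
From mathcomp Require Import boolp classical_sets reals lra ring zify.

Import Order.TTheory GRing.Theory Num.Theory.
Local Open Scope ring_scope.

Set Implicit Arguments.
Unset Strict Implicit.
Unset Printing Implicit Defensive.

(** * Farkas' lemma *)

(* Induction on the vectors, after Bartl: if dropping [a j] breaks the hypothesis,
   a witness [x] of this satisfies [a j x > 0]; replacing every [g] by
   [g - g(x)/a_j(x) a_j] then gives functionals that ignore [a j]. *)
Lemma farkas (R : realFieldType) (V I : finType) (s : seq I) (a : I -> V -> R)
    (b : V -> R) :
  uniq s ->
  (forall y : V -> R, (forall i, i \in s -> \sum_v a i v * y v <= 0) ->
     \sum_v b v * y v <= 0) ->
  exists2 w : I -> R, forall i, 0 <= w i
    & forall v, b v = \sum_(i <- s) w i * a i v.
Proof.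
elim: s a b => [|j s IHs] a b /=.
  move=> _ H; exists (fun=> 0) => // v; rewrite big_nil.
  (* Testing with [y := b] gives a sum of squares that is at most 0. *)
  have /= := H b (fun i => ltac:(by [])).
  have sq_ge0 u : true -> 0 <= b u * b u by rewrite -expr2 sqr_ge0.
  move=> le0; have /eqP : \sum_u b u * b u = 0.
    by apply/eqP; rewrite eq_le le0 sumr_ge0.
  rewrite psumr_eq0 // => /allP /(_ v (mem_index_enum v)).
  by rewrite mulf_eq0 orbb => /eqP.
case/andP=> js us H.
have [Hs|/existsPNP[x ax /negP]] := pselect (forall y : V -> R,
    (forall i, i \in s -> \sum_v a i v * y v <= 0) -> \sum_v b v * y v <= 0).
  have [w w0 wE] := IHs a b us Hs.
  exists (fun i => if i == j then 0 else w i) => [i|v]; first by case: ifP.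
  rewrite big_cons eqxx mul0r add0r wE; apply: eq_big_seq => i si.
  by case: eqP => // ij; rewrite -ij si in js.
rewrite -ltNge => bx.
have ajx : 0 < \sum_v a j v * x v.
  rewrite ltNge; apply/negP => ajx; have := H x; rewrite leNgt bx => /(_ _)/negP.
  by apply=> // i; rewrite inE => /predU1P[->|/ax].
set m := \sum_v a j v * x v in ajx.
pose c (g : V -> R) := (\sum_v g v * x v) / m.
pose pr (g : V -> R) v := g v - c g * a j v.
have sum_pr g y : \sum_v pr g v * y v =
    \sum_v g v * (y v - (\sum_u a j u * y u) / m * x v).
  transitivity (\sum_v g v * y v - c g * \sum_v a j v * y v).
    by rewrite mulr_sumr -sumrB; apply: eq_bigr => v _; rewrite /pr; ring.
  transitivity (\sum_v g v * y v - (\sum_u a j u * y u) / m * \sum_v g v * x v).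
    by rewrite /c; ring.
  by rewrite mulr_sumr -sumrB; apply: eq_bigr => v _; ring.
have [|w w0 wE] := IHs (fun i => pr (a i)) (pr b) us.
  move=> y Hy; rewrite sum_pr; apply: H => i; rewrite inE => /predU1P[->|si].
    rewrite -sum_pr big1 // => v _; rewrite /pr /c -/m divff ?gt_eqF //.
    by rewrite mul1r subrr mul0r.
  by rewrite -sum_pr Hy.
(* The weight at [j] is nonnegative: [x] makes [c b] positive and every [c (a l)] with [l] in [s]
   nonpositive. *)
exists (fun i => if i == j then c b - \sum_(l <- s) w l * c (a l) else w i).
  move=> i; case: ifP => // _; rewrite subr_ge0.
  apply: (@le_trans _ _ 0); last by rewrite divr_ge0 // ltW.
  rewrite big_seq sumr_le0 // => l sl.
  by rewrite mulr_ge0_le0 // mulr_le0_ge0 ?ax // invr_ge0 ltW.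
move=> v; rewrite big_cons eqxx.
transitivity ((c b - \sum_(l <- s) w l * c (a l)) * a j v
   + \sum_(l <- s) w l * a l v); last first.
  congr (_ + _); apply: eq_big_seq => i si.
  by case: eqP => // ij; rewrite -ij si in js.
have : \sum_(l <- s) w l * pr (a l) v =
    \sum_(l <- s) w l * a l v - (\sum_(l <- s) w l * c (a l)) * a j v.
  by rewrite mulr_suml -sumrB; apply: eq_bigr => l _; rewrite /pr; ring.
by rewrite -wE {1}/pr => /(canRL (subrK _)) ->; ring.
Qed.

(** * Minima, degrees and common neighbours *)

Lemma bigminn_leq (I : eqType) (r : seq I) (P : pred I) (F : I -> nat) x i :
  i \in r -> P i -> (\big[minn/x]_(j <- r | P j) F j <= F i)%N.
Proof.
by rewrite -minEnat -leEnat => ri Pi; apply: bigmin_inf_seq ri Pi _.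
Qed.

Lemma bigminn_attained (I : finType) (P : pred I) (F : I -> nat) x i :
  P i -> (forall j, P j -> (F j <= x)%N) ->
  exists2 j, P j & \big[minn/x]_(l | P l) F l = F j.
Proof.
by move=> Pi leFx; rewrite -minEnat; have [j Pj ->] := eq_bigmin _ _ F Pi leFx; exists j.
Qed.

Lemma leq_min_degree (G : sgraph) x :
  (x <= #|G|)%N -> (forall v : G, (x <= degree v)%N) -> (x <= min_degree G)%N.
Proof.
move=> xG xd; rewrite /min_degree; elim/big_ind: _ => // m n xm xn.
by rewrite leq_min xm.
Qed.

Lemma min_degree_leq (G : sgraph) (v : G) : (min_degree G <= degree v)%N.
Proof. exact: (bigminn_leq _ _ (mem_index_enum v)). Qed.

Lemma card_nonneighbours (G : sgraph) (v : G) :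
  (#|[set u | ~~ edge v u]| <= #|G| - min_degree G)%N.
Proof.
have := cardsC [set u | edge v u]; have := min_degree_leq v; rewrite /degree.
have -> : ~: [set u | edge v u] = [set u | ~~ edge v u].
  by apply/setP=> u; rewrite !inE.
lia.
Qed.

(** Union bound over the entries of [s]. *)
Lemma card_common_nonneighbours (G : sgraph) (s : seq G) :
  (#|[set u | ~~ all (edge u) s]| <= size s * (#|G| - min_degree G))%N.
Proof.
elim: s => [|v s IHs]; first by rewrite eq_card0 // => u; rewrite inE.
have -> : [set u | ~~ all (edge u) (v :: s)] =
    [set u | ~~ edge v u] :|: [set u | ~~ all (edge u) s].
  by apply/setP=> u; rewrite !inE /= negb_and edge_sym.
apply: leq_trans (leq_card_setU _ _) _.
by rewrite mulSn leq_add ?card_nonneighbours.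
Qed.

Lemma card_common_neighbours (G : sgraph) (s : seq G) r :
  (r + size s * (#|G| - min_degree G) <= #|G|)%N ->
  (r <= #|[set u | all (edge u) s]|)%N.
Proof.
have := card_common_nonneighbours s; have := cardsC [set u | all (edge u) s].
have -> : ~: [set u | all (edge u) s] = [set u | ~~ all (edge u) s].
  by apply/setP=> u; rewrite !inE.
lia.
Qed.

(** * Cliques from common neighbours *)

(** The consequence of the degree condition that yields cliques: [r = 1] lets them grow to [k]
    vertices, [r = 2] also offers a second choice for a vertex. Lists may have repetitions. *)
Definition joined k (G : sgraph) r :=
  forall s : seq G, (size s < k)%N -> (r <= #|[set u | all (edge u) s]|)%N.

Lemma joined_neighbour k (G : sgraph) (s : seq G) :
  joined k G 1 -> (size s < k)%N -> exists u, all (edge u) s.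
Proof. by move=> jG /jG; rewrite card_gt0 => /set0Pn[u]; rewrite inE; exists u. Qed.

Lemma extend_clique k (G : sgraph) (s : seq G) :
  joined k G 1 -> pairwise (@edge G) s -> (size s <= k)%N ->
  exists2 p, pairwise (@edge G) (s ++ p) & size (s ++ p) = k.
Proof.
move=> jG; move Dm: (k - size s)%N => m.
elim: m s Dm => [|m IHm] s Dm cs sk.
  by exists [::]; rewrite cats0 //; apply/eqP; rewrite eqn_leq sk -subn_eq0 Dm.
have [|u us] := joined_neighbour (s := s) jG; first lia.
have [|||p] := IHm (rcons s u); rewrite ?size_rcons; try lia.
  rewrite pairwise_rcons cs andbT; apply: sub_all us => v /=.
  by rewrite edge_sym.
by rewrite -cats1 -catA; exists ([:: u] ++ p); rewrite // -cats1 -catA.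
Qed.

Definition clique_map k (G : sgraph) (t : 'I_k -> G) :=
  forall i j, i != j -> edge (t i) (t j).

Lemma clique_map_nth k (G : sgraph) (s : seq G) (x0 : G) :
  pairwise (@edge G) s -> size s = k ->
  clique_map (fun i : 'I_k => nth x0 s i).
Proof.
move=> /(pairwiseP x0) cs sk i j ij.
wlog lij : i j ij / (i < j)%N => [H|].
  have := ij; rewrite -val_eqE neq_ltn => /orP[|ji]; first exact: H.
  by rewrite edge_sym H // eq_sym.
by apply: cs => //; rewrite inE sk.
Qed.

(** Positions 0 and 1 match the two colours compared in [class_diffs], so that exchanging these
    colours exchanges [x] and [y]. *)
Lemma clique_through k (G : sgraph) (x y : G) :
  joined k.+2 G 1 -> edge x y ->
  exists t : 'I_k.+2 -> G, [/\ clique_map t, t 0 = x & t 1 = y].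
Proof.
move=> jG exy.
have [//|/= p cp sp] := extend_clique (s := [:: x; y]) jG (ltac:(by rewrite /= exy)).
exists (fun i : 'I_k.+2 => nth x ([:: x; y] ++ p) i); split=> //.
exact: clique_map_nth.
Qed.

(** * Colourings and homomorphisms *)

Lemma colouring_neq (F : sgraph) k (c : {ffun F -> 'I_k}) u v :
  proper_colouring c -> edge u v -> c u != c v.
Proof. by move/forallP/(_ u)/forallP/(_ v)/implyP. Qed.

Lemma chi_colouring (F : sgraph) :
  exists c : {ffun F -> 'I_(chi F)}, proper_colouring c.
Proof. by rewrite /chi; case: ex_minnP => k /existsP. Qed.

Lemma chi_leq (F : sgraph) k (c : {ffun F -> 'I_k}) :
  proper_colouring c -> (chi F <= k)%N.
Proof.
by move=> pc; rewrite /chi; case: ex_minnP => l _; apply; apply/existsP; exists c.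
Qed.

Lemma graph_homP (F G : sgraph) (f : F -> G) :
  (forall u v, edge u v -> edge (f u) (f v)) ->
  exists phi : graph_hom F G, val phi =1 f.
Proof.
move=> Hf; have H : is_hom [ffun u => f u].
  by apply/forallP=> u; apply/forallP=> v; apply/implyP; rewrite !ffunE; apply: Hf.
by exists (Sub _ H) => u; rewrite /= ffunE.
Qed.

Lemma clique_hom (F G : sgraph) k (c : {ffun F -> 'I_k}) (t : 'I_k -> G) :
  proper_colouring c -> clique_map t ->
  exists phi : graph_hom F G, forall u, val phi u = t (c u).
Proof. by move=> pc ct; apply: graph_homP => u v /(colouring_neq pc)/ct. Qed.

Lemma natr_card (R : pzSemiRingType) (T : finType) (P : pred T) :
  #|[set u | P u]|%:R = \sum_u (P u)%:R :> R.
Proof.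
rewrite -sum1_card natr_sum big_mkcond /=; apply: eq_bigr => u _.
by rewrite inE; case: ifP.
Qed.

Lemma fibre_sizeE (R : pzSemiRingType) (F G : sgraph) (phi : graph_hom F G) (v : G) :
  (fibre_size phi v)%:R = \sum_u (val phi u == v)%:R :> R.
Proof.
exact: natr_card.
Qed.

Lemma clique_map_perm k (G : sgraph) (t : 'I_k -> G) (f : 'I_k -> 'I_k) :
  injective f -> clique_map t -> clique_map (t \o f).
Proof. by move=> fI ct i j ij; apply: ct; rewrite (inj_eq fI). Qed.

(** * Covering *)

(** Only [u0] goes to [x]; the rest of its colour class goes to some [z] other than [x] that
    completes the same clique. No edge of [F] lies inside a class, so [x] and [z] need not be
    adjacent. *)
Lemma Cov_joined (F G : sgraph) (u0 : F) k :
  chi F = k.+2 -> joined k.+2 G 2 -> Cov F G.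
Proof.
move=> Fk jG x.
have jG1 : joined k.+2 G 1 by move=> s /jG; apply: leq_trans.
have [|y] := joined_neighbour (s := [:: x]) jG1; first by [].
rewrite /= andbT edge_sym => exy.
have [t [ct t0 _]] := clique_through jG1 exy.
have [c pc] := chi_colouring F; rewrite Fk in c pc.
(* The transposition moves [x] to the position given by the colour of [u0]. *)
pose t' := t \o tperm 0 (c u0).
have ct' : clique_map t' by apply: clique_map_perm ct; apply: perm_inj.
have t'x : t' (c u0) = x by rewrite /t' /= tpermR.
(* The other k + 1 clique vertices have two common neighbours, one of which differs from [x]. *)
have := jG [seq t' (lift (c u0) j) | j <- enum 'I_k.+1].
rewrite size_map size_enum_ord => /(_ (leqnn _)) /card_gt1P[z1 [z2]].
rewrite !inE => -[z1A z2A z12].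
have [z zx /allP zA] : exists2 z, z != x &
    all (edge z) [seq t' (lift (c u0) j) | j <- enum 'I_k.+1].
  by have [z1x|] := eqVneq z1 x; [exists z2; rewrite // eq_sym -z1x | exists z1].
have zt j : j != c u0 -> edge z (t' j).
  rewrite eq_sym => /unlift_some[l -> _]; apply: zA; apply: map_f.
  exact: mem_enum.
pose f u := if u == u0 then x else if c u == c u0 then z else t' (c u).
have f1 u j : c u = c u0 -> j != c u0 -> edge (f u) (t' j).
  move=> cu ju; rewrite /f cu eqxx; case: eqP => _; last exact: zt.
  by rewrite -t'x ct' // eq_sym.
have f2 u : c u != c u0 -> f u = t' (c u).
  by move=> cu; rewrite /f (negPf cu); case: (u =P u0) cu => // ->; rewrite eqxx.
have [|phi phiE] := graph_homP (F := F) (f := f).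
  move=> u v /(colouring_neq pc) cuv.
  have [cu|cu] := eqVneq (c u) (c u0).
    by rewrite (f2 v) ?f1 // -cu eq_sym.
  have [cv|cv] := eqVneq (c v) (c u0); last by rewrite !f2 // ct'.
  by rewrite edge_sym (f2 u) ?f1.
exists phi; rewrite /fibre_size -[RHS](cards1 u0); congr #|pred_of_set _|.
apply/setP=> u; rewrite !inE phiE.
have [->|uu0] := eqVneq u u0; first by rewrite /f eqxx eqxx.
have [cu|cu] := eqVneq (c u) (c u0).
  by rewrite /f cu eqxx (negPf uu0) (negPf zx).
rewrite f2 //; apply: contraTF (ct' _ _ cu) => /eqP->.
by rewrite t'x edge_irrefl.
Qed.

(** * Integral tilings *)

(** The integer span of the fibre-size vectors; [Div] says that it contains the constant 1. *)
Definition lattice (R : realType) (F G : sgraph) (g : G -> R) : Prop :=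
  exists2 w : graph_hom F G -> R,
    forall v, \sum_phi w phi * (fibre_size phi v)%:R = g v
    & forall phi, w phi \is a Num.int.
Arguments lattice {R} F {G} g.

Lemma eq_lattice (R : realType) (F G : sgraph) (g h : G -> R) :
  g =1 h -> lattice F g -> lattice F h.
Proof. by move=> gh [w wg wi]; exists w => // v; rewrite wg. Qed.

Lemma lattice_hom (R : realType) (F G : sgraph) (phi : graph_hom F G) :
  lattice F (fun v => \sum_u (val phi u == v)%:R : R).
Proof.
exists (fun psi => (psi == phi)%:R) => [v|psi]; last by case: eqP.
rewrite (bigD1 phi) //= eqxx mul1r big1 ?addr0 ?fibre_sizeE //.
by move=> psi /negPf->; rewrite mul0r.
Qed.

Lemma lattice0 (R : realType) (F G : sgraph) : lattice F (fun=> 0 : R) (G := G).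
Proof.
exists (fun=> 0) => [v|_]; last exact: rpred0.
by rewrite big1 // => phi _; rewrite mul0r.
Qed.

Lemma latticeD (R : realType) (F G : sgraph) (g h : G -> R) :
  lattice F g -> lattice F h -> lattice F (fun v => g v + h v).
Proof.
move=> [w wg wi] [z zh zi]; exists (fun phi => w phi + z phi) => [v|phi].
  by rewrite -wg -zh -big_split; apply: eq_bigr => phi _; rewrite mulrDl.
by rewrite rpredD.
Qed.

Lemma latticeZ (R : realType) (F G : sgraph) (a : R) (g : G -> R) :
  a \is a Num.int -> lattice F g -> lattice F (fun v => a * g v).
Proof.
move=> ai [w wg wi]; exists (fun phi => a * w phi) => [v|phi].
  by rewrite -wg mulr_sumr; apply: eq_bigr => phi _; rewrite mulrA.
by rewrite rpredM.
Qed.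

Lemma latticeB (R : realType) (F G : sgraph) (g h : G -> R) :
  lattice F g -> lattice F h -> lattice F (fun v => g v - h v).
Proof.
move=> Lg Lh; have /(latticeD Lg) := latticeZ (rpredN1 _) Lh.
by apply: eq_lattice => v; rewrite mulN1r.
Qed.

Lemma lattice_sum (R : realType) (F G : sgraph) (I : Type) (r : seq I)
    (g : I -> G -> R) :
  (forall i, lattice F (g i)) -> lattice F (fun v => \sum_(i <- r) g i v).
Proof.
move=> Lg; elim: r => [|i r IHr].
  by apply: eq_lattice (lattice0 R F G) => v; rewrite big_nil.
by apply: eq_lattice (latticeD (Lg i) IHr) => v; rewrite big_cons.
Qed.

(* The integers [a] for which [a (e_x - e_y)] lies in the lattice form an ideal;
   exchanging two colours puts the differences of class sizes in this ideal. *)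
Lemma lattice_edge (R : realType) (F G : sgraph) k (x y : G) :
  chi F = k.+2 -> gcd_graph F = Some 1%N -> joined k.+2 G 1 -> edge x y ->
  lattice F (fun v => (x == v)%:R - (y == v)%:R : R).
Proof.
move=> Fk Fgcd jG exy; have [t [ct t0 t1]] := clique_through jG exy.
pose e v : R := (x == v)%:R - (y == v)%:R.
pose ideal d := lattice F (fun v => d%:R * e v).
suff : ideal 1%N by apply: eq_lattice => v; rewrite mul1r.
have ideal_diff d : d \in class_diffs F -> ideal d.
  rewrite /class_diffs Fk => /mapP[c]; rewrite mem_enum inE => pc ->.
  have diff_lattice : lattice F
      (fun v => ((class_size c 0)%:R - (class_size c 1)%:R) * e v).
    have [phi phiE] := clique_hom pc ct.
    have [psi psiE] := clique_hom pc (clique_map_perm (@perm_inj _ (tperm 0 1)) ct).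
    (* The difference of the two homomorphisms is [e] on a vertex of colour 0, [- e] on one of
       colour 1, and cancels on all others. *)
    apply: eq_lattice (latticeB (lattice_hom R phi) (lattice_hom R psi)) => v.
    rewrite /class_size !natr_card -!sumrB mulr_suml; apply: eq_bigr => u _.
    rewrite phiE psiE /= /e -t0 -t1.
    case: tpermP => [->|->|/eqP/negPf c0 /eqP/negPf c1] /=; try ring.
    by rewrite -val_eqE -val_eqE /= in c0 c1; rewrite c0 c1; ring.
  have [le|/ltnW le] := leqP (class_size c 0) (class_size c 1).
    have /(latticeZ (rpredN1 _)) := diff_lattice.
    by apply: eq_lattice => v; rewrite distnEr // natrB //; ring.
  by apply: eq_lattice diff_lattice => v; rewrite distnEl // natrB.
have ideal_gcd m n : ideal m -> ideal n -> ideal (gcdn m n).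
  move=> Im In; have [->|m0] := posnP m; first by rewrite gcd0n.
  have [p q E _] := egcdnP n m0.
  have /(latticeB (latticeZ (natr_int R p) Im)) := latticeZ (natr_int R q) In.
  by apply: eq_lattice => v; rewrite !mulrA -!natrM E natrD; ring.
(* The iterated gcd starts from 0. *)
have ideal0 : ideal 0%N.
  by apply: eq_lattice (lattice0 R F G) => v; rewrite mul0r.
move: Fgcd; rewrite /gcd_graph; case: ifP => // _ [<-].
by rewrite big_seq_cond; apply: big_ind => // d /andP[/ideal_diff].
Qed.

(** As [chi F] is at least 3, any two vertices have a common neighbour, so every e_x - e_y is in the
    lattice. Moving a whole homomorphism to [x0] gives |F| e_x0; [q] copies of it and all e_v - e_x0
    add up to the all-one vector. *)
Lemma Div_joined (R : realType) (F G : sgraph) (x0 : G) k :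
  chi F = k.+3 -> gcd_graph F = Some 1%N -> (#|F| %| #|G|)%N -> joined k.+3 G 1 ->
  Div R F G.
Proof.
move=> Fk Fgcd /dvdnP[q Gq] jG.
have Lxy (x y : G) : lattice F (fun v => (x == v)%:R - (y == v)%:R : R).
  have [|z /and3P[zx zy _]] := joined_neighbour (s := [:: x; y]) jG; first by [].
  have Lx : lattice F (fun v => (x == v)%:R - (z == v)%:R : R).
    by apply: lattice_edge Fk Fgcd jG _; rewrite edge_sym.
  apply: eq_lattice (latticeD Lx (lattice_edge R Fk Fgcd jG zy)) => v.
  by rewrite addrA subrK.
have [y0] := joined_neighbour (s := [:: x0]) jG isT.
rewrite /= andbT edge_sym => exy0; have [t [ct _ _]] := clique_through jG exy0.
have [c pc] := chi_colouring F; rewrite Fk in c pc.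
have [phi _] := clique_hom pc ct.
have Lphi := latticeB (lattice_hom R phi)
  (lattice_sum (index_enum F) (fun u => Lxy (val phi u) x0)).
have := latticeD (latticeZ (natr_int R q) Lphi)
  (lattice_sum (index_enum G) (fun v => Lxy v x0)).
apply: eq_lattice => v.
rewrite !sumrB subKr !sumr_const [X in _ + (X - _)](bigD1 v) //= eqxx.
rewrite [X in 1 + X]big1 => [|w /negPf->//]; rewrite addr0.
rewrite -[_ *+ #|F|]mulr_natl -[_ *+ #|_|]mulr_natl.
have -> : #|[pred _ : G | true]| = #|G| by [].
rewrite Gq natrM mulrA; ring.
Qed.

(** * Fractional tilings *)

(* At each step [v] maximises [y] over the remaining common neighbours, and at
   most [D] of them are lost. *)
Lemma greedy_clique (R : realFieldType) (G : sgraph) (y : G -> R) (D : R) k j :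
  (forall v : G, #|[set u | ~~ edge v u]|%:R <= D) ->
  joined k G 1 -> (j <= k)%N ->
  exists s : seq G, [/\ pairwise (@edge G) s, size s = j,
    forall u v, all (edge u) s -> v \in s -> y u <= y v
    & forall z, (forall v, v \in s -> z <= y v) ->
      \sum_(u | ~~ all (edge u) s) (y u - z) <= D * \sum_(v <- s) (y v - z)].
Proof.
move=> nonD jG; elim: j => [|j IHj] jk.
  exists [::]; split=> // z _; rewrite big_nil mulr0 big_pred0 //.
have [|s [cs sj ys sums]] := IHj; first exact: ltnW.
have [|u0 u0s] := joined_neighbour (s := s) jG; first by rewrite sj.
have [v vs vmax] := arg_maxP (P := fun u => all (edge u) s) y u0s.
exists (v :: s); split=> /=; first by rewrite vs.
- by rewrite sj.
- move=> u w /andP[_ us]; rewrite inE => /predU1P[->|ws]; first exact: vmax.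
  exact: ys.
move=> z zle; have zv : z <= y v by apply: zle; rewrite mem_head.
(* Vertices lost earlier are handled by induction; a newly lost one is joined to [s], so its value
   is at most [y v], and it is among the at most [D] non-neighbours of [v]. *)
rewrite big_cons mulrDr addrC (bigID (fun u => ~~ all (edge u) s)) /=.
apply: lerD.
  rewrite (eq_bigl (fun u => ~~ all (edge u) s)) => [|u].
    by apply: sums => w ws; apply: zle; rewrite inE ws orbT.
  by rewrite negb_and andb_orl andbb; case: (edge u v); case: all.
apply: le_trans (_ : \sum_(u | ~~ edge v u) (y v - z) <= _); last first.
  rewrite sumr_const -mulr_natl ler_wpM2r ?subr_ge0 //.
  by apply: le_trans (nonD v); rewrite cardsE.
rewrite big_mkcond [leRHS]big_mkcond; apply: ler_sum => u _.
rewrite negbK edge_sym; case us: all; case: edge; rewrite ?lexx ?subr_ge0 //=.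
by rewrite lerD2r; apply: vmax.
Qed.

Lemma sum_fibre_size (R : pzSemiRingType) (F G : sgraph) (phi : graph_hom F G)
    (y : G -> R) :
  \sum_v (fibre_size phi v)%:R * y v = \sum_u y (val phi u).
Proof.
under eq_bigr do rewrite fibre_sizeE mulr_suml.
rewrite exchange_big; apply: eq_bigr => u _.
rewrite (bigD1 (val phi u)) //= eqxx mul1r big1 ?addr0 // => v /negPf.
by rewrite eq_sym => ->; rewrite mul0r.
Qed.

Lemma class_size_leq (F : sgraph) k (c : {ffun F -> 'I_k}) i :
  (class_size c i <= #|F|)%N.
Proof. exact: max_card. Qed.

Lemma min_class_size_leq (F : sgraph) k (c : {ffun F -> 'I_k}) (i : 'I_k) :
  chi F = k -> proper_colouring c -> (min_class_size F <= class_size c i)%N.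
Proof.
move=> Fk; subst k => pc.
apply: (@leq_trans (\big[minn/#|F|]_(j < chi F) class_size c j)).
  exact: (bigminn_leq _ _ (mem_index_enum c)).
exact: (bigminn_leq _ _ (mem_index_enum i)).
Qed.

Lemma min_class_size_attained (F : sgraph) k : chi F = k.+1 ->
  exists c : {ffun F -> 'I_k.+1}, exists2 i : 'I_k.+1,
    proper_colouring c & min_class_size F = class_size c i.
Proof.
move=> Fk; have [c pc] := chi_colouring F; rewrite /min_class_size.
move: c pc; rewrite Fk => c pc.
have le1 (d : {ffun F -> 'I_k.+1}) :
    (\big[minn/#|F|]_(i < k.+1) class_size d i <= #|F|)%N.
  apply: leq_trans (class_size_leq d 0).
  exact: (bigminn_leq _ _ (mem_index_enum (0 : 'I_k.+1))).
have [d pd ->] := bigminn_attained pc (fun d _ => le1 d).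
have [i _ ->] := @bigminn_attained 'I_k.+1 predT (fun i => class_size d i)
  #|F| (0 : 'I_k.+1) isT (fun i _ => class_size_leq d i).
by exists d, i.
Qed.

(* Cyclically permuting all colours but the smallest one makes
   [F] use the clique with weights [m, (#|F| - m) / (k + 1), ..., (#|F| - m) / (k + 1)]. *)
Lemma Spa_dual (R : realType) (F G : sgraph) (D : R) k (c : {ffun F -> 'I_k.+2})
    (i0 : 'I_k.+2) (m := class_size c i0) (y : G -> R) :
  proper_colouring c -> joined k.+2 G 1 ->
  (forall v : G, #|[set u | ~~ edge v u]|%:R <= D) ->
  k.+1%:R * #|F|%:R * D <= (#|F|%:R - m%:R) * #|G|%:R -> (0 < #|F|)%N ->
  (forall phi : graph_hom F G, \sum_v (fibre_size phi v)%:R * y v <= 0) ->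
  \sum_v y v <= 0.
Proof.
move=> pc jG nonD DF F0 Hy.
(* The clique consists of the k + 1 greedy vertices [s] and their best common neighbour [z], where
   [y] is least on the clique. *)
have [s [cs sk ys sums]] := greedy_clique y nonD jG (leqnSn k.+1).
have [|u0 u0s] := joined_neighbour (s := s) jG; first by rewrite sk.
have [z zs zmax] := arg_maxP (P := fun u => all (edge u) s) y u0s.
have zle v : v \in s -> y z <= y v by apply: ys.
pose t (i : 'I_k.+1) := nth z s i.
have ct : clique_map t by apply: clique_map_nth.
have zt i : edge z (t i) by apply/(allP zs)/mem_nth; rewrite sk.
have rot_hom (r : 'I_k.+1) : exists phi : graph_hom F G, forall u,
    val phi u = if unlift i0 (c u) is Some i then t (i + r) else z.
  pose T j := if unlift i0 j is Some i then t (i + r) else z.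
  have [|phi phiE] := clique_hom (G := G) (t := T) pc; last by exists phi.
  move=> i j ij; rewrite /T; case: unliftP ij => [i' ->|->]; case: unliftP => [j' ->|->].
  - by rewrite (inj_eq lift_inj) => ij; apply: ct; rewrite (inj_eq (addIr _)).
  - by rewrite edge_sym.
  - by [].
  - by rewrite eqxx.
pose Y := \sum_(v <- s) y v.
have YE : Y = \sum_i y (t i) by rewrite /Y (big_nth z) sk big_mkord.
(* Over the k + 1 rotations, a vertex of class [i0] gives [y z] each time, and any other vertex runs
   once through [s]. *)
have weighted : m%:R * (k.+1%:R * y z) + (#|F|%:R - m%:R) * Y <= 0.
  have mE : m%:R = \sum_u (c u == i0)%:R :> R by rewrite /m /class_size natr_card.
  have <- : \sum_(r < k.+1) \sum_u
      (if unlift i0 (c u) is Some i then y (t (i + r)) else y z) =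
      m%:R * (k.+1%:R * y z) + (#|F|%:R - m%:R) * Y.
    have -> : #|F|%:R = \sum_(u : F) 1 :> R by rewrite sumr_const.
    rewrite exchange_big mE -sumrB !mulr_suml -big_split; apply: eq_bigr => u _.
    case: unliftP => [j ->|->] /=.
      rewrite eq_sym (negPf (neq_lift _ _)) mul0r add0r subr0 mul1r YE.
      by rewrite [RHS](reindex_inj (addrI j)).
    by rewrite eqxx sumr_const card_ord -[LHS]mulr_natl subrr mul0r addr0 mul1r.
  apply: sumr_le0 => r _; have [phi phiE] := rot_hom r.
  apply: le_trans (Hy phi); rewrite sum_fibre_size; apply: ler_sum => u _.
  by rewrite phiE; case: unlift.
have YzE : \sum_(v <- s) (y v - y z) = Y - k.+1%:R * y z.
  rewrite (big_nth z) sk big_mkord sumrB -YE sumr_const card_ord.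
  by rewrite -[_ *+ k.+1]mulr_natl.
(* Vertices joined to [s] contribute at most 0 by the choice of [z]; [sums] bounds the others. *)
have sum_le : \sum_v y v - #|G|%:R * y z <= D * (Y - k.+1%:R * y z).
  have -> : \sum_v y v - #|G|%:R * y z = \sum_v (y v - y z).
    by rewrite sumrB sumr_const mulr_natl.
  rewrite -YzE; apply: le_trans (sums _ zle).
  rewrite (bigID (fun u => all (edge u) s)) /= gerDr sumr_le0 // => u us.
  by rewrite subr_le0; apply: zmax.
have Y_ge : 0 <= Y - k.+1%:R * y z.
  by rewrite -YzE big_seq sumr_ge0 // => v vs; rewrite subr_ge0 zle.
(* After scaling by (k + 1) |F|, [DF] turns the bound [sum_le] into |G| times the expression in
   [weighted]. *)
have kF0 : 0 < k.+1%:R * #|F|%:R :> R by rewrite mulr_gt0 ?ltr0n.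
rewrite -(pmulr_rle0 _ kF0).
have : #|G|%:R * (m%:R * (k.+1%:R * y z) + (#|F|%:R - m%:R) * Y) <= 0.
  by rewrite mulr_ge0_le0.
have := ler_wpM2r Y_ge DF; have := ler_wpM2l (ltW kF0) sum_le.
lra.
Qed.

(** Farkas' lemma for the fibre-size vectors and the all-one target, with [Spa_dual] as its
    hypothesis. *)
Lemma Spa_joined (R : realType) (F G : sgraph) (D : R) k :
  chi F = k.+2 -> joined k.+2 G 1 ->
  (forall v : G, #|[set u | ~~ edge v u]|%:R <= D) ->
  k.+1%:R * #|F|%:R * D <= (#|F|%:R - (min_class_size F)%:R) * #|G|%:R ->
  (0 < #|F|)%N -> Spa R F G.
Proof.
move=> Fk jG nonD DF F0.
have [c [i pc mE]] := min_class_size_attained Fk; rewrite mE in DF.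
have [y Hy|w w0 wE] := @farkas R G (graph_hom F G) (index_enum _)
    (fun phi v => (fibre_size phi v)%:R) (fun=> 1) (index_enum_uniq _).
  rewrite (eq_bigr y) => [|v _]; last by rewrite mul1r.
  apply: Spa_dual pc jG nonD DF F0 _ => phi; exact: Hy (mem_index_enum _).
exists w => // phi; rewrite w0 /=.
(* A weight is at most 1 because [phi] meets the vertex [val phi u0], where the total is 1. *)
have [u0 _] : exists u : F, u \in predT by apply/card_gt0P.
rewrite [leRHS](wE (val phi u0)) (bigD1 phi) //=.
apply: le_trans (_ : w phi * (fibre_size phi (val phi u0))%:R <= _).
  rewrite ler_peMr // ler1n card_gt0; apply/set0Pn; exists u0.
  by rewrite inE.
by rewrite lerDl sumr_ge0 // => psi _; rewrite mulr_ge0.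
Qed.

(** * Complete multipartite graphs *)

Lemma multipartite_sym k (m : 'I_k -> nat) :
  symmetric (fun x y : {i : 'I_k & 'I_(m i)} => tag x != tag y).
Proof. by move=> x y; rewrite eq_sym. Qed.

Lemma multipartite_irrefl k (m : 'I_k -> nat) :
  irreflexive (fun x y : {i : 'I_k & 'I_(m i)} => tag x != tag y).
Proof. by move=> x; rewrite eqxx. Qed.

Definition multipartite k (m : 'I_k -> nat) : sgraph :=
  SGraph (@multipartite_sym k m) (@multipartite_irrefl k m).

Lemma card_multipartite k (m : 'I_k -> nat) : #|multipartite m| = (\sum_i m i)%N.
Proof.
rewrite -sum1_card -(sig_big_dep xpredT (fun _ => xpredT) (fun _ _ => 1%N)) /=.
by apply: eq_bigr => i _; rewrite sum1_card card_ord.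
Qed.

Lemma card_multipartite_part k (m : 'I_k -> nat) i :
  #|[set x : multipartite m | tag x == i]| = m i.
Proof.
rewrite -sum1_card (eq_bigl (fun x : multipartite m => (tag x == i) && true)) => [|x].
  rewrite -(sig_big_dep (fun j => j == i) (fun _ => xpredT) (fun _ _ => 1%N)) /=.
  by rewrite big_pred1_eq sum1_card card_ord.
by rewrite inE andbT.
Qed.

Lemma min_degree_multipartite k (m : 'I_k -> nat) M :
  (forall i, (m i <= M)%N) -> (#|multipartite m| - M <= min_degree (multipartite m))%N.
Proof.
move=> mM; apply: leq_min_degree => [|x]; first exact: leq_subr.
rewrite leq_subLR -(cardsC [set y : multipartite m | edge x y]) addnC leq_add2r.
apply: leq_trans (mM (tag x)); rewrite -(card_multipartite_part m (tag x)).
by apply/subset_leq_card/fintype.subsetP => y; rewrite !inE /= negbK eq_sym.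
Qed.

Lemma multipartite_colouring (F : sgraph) k (m : 'I_k -> nat)
    (phi : graph_hom F (multipartite m)) :
  proper_colouring [ffun u => tag (val phi u)].
Proof.
apply/forallP=> u; apply/forallP=> v; rewrite !ffunE.
by have /forallP/(_ u)/forallP/(_ v) := valP phi.
Qed.

Lemma perfect_tiling_sum (R : realType) (F G : sgraph) (w : graph_hom F G -> R)
    (y : G -> R) :
  perfect_tiling w ->
  \sum_v y v = \sum_phi w phi * \sum_u y (val phi u).
Proof.
move=> wP; transitivity (\sum_v y v * \sum_phi w phi * (fibre_size phi v)%:R).
  by apply: eq_bigr => v _; rewrite wP mulr1.
under eq_bigr do rewrite mulr_sumr.
rewrite exchange_big; apply: eq_bigr => phi _ /=.
by rewrite -sum_fibre_size mulr_sumr; apply: eq_bigr => v _; ring.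
Qed.

Lemma no_hom_not_tiled (R : realType) (F G : sgraph) (w : graph_hom F G -> R) :
  (graph_hom F G -> False) -> (0 < #|G|)%N -> ~ perfect_tiling w.
Proof.
move=> nohom /card_gt0P[v _] /(_ v); rewrite big1 => [/esym/eqP|phi].
  by rewrite oner_eq0.
by case: (nohom phi).
Qed.

(** An empty class could be dropped, leaving a proper colouring with k + 1 colours. *)
Lemma min_class_size_gt0 (F : sgraph) k : chi F = k.+2 -> (0 < min_class_size F)%N.
Proof.
move=> Fk; have [c [i pc ->]] := min_class_size_attained Fk.
rewrite lt0n; apply/negP => /eqP/cards0_eq c0.
have ci u : c u != i.
  by have /setP/(_ u) := c0; rewrite !inE val_eqE => ->.
pose d : {ffun F -> 'I_k.+1} := [ffun u => odflt 0 (unlift i (c u))].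
have /chi_leq : proper_colouring d; last by rewrite Fk ltnn.
apply/forallP=> u; apply/forallP=> v; apply/implyP=> /(colouring_neq pc).
rewrite !ffunE; case: unliftP (ci u) => [a ->|->]; last by rewrite eqxx.
case: unliftP (ci v) => [b ->|->]; last by rewrite eqxx.
by rewrite (inj_eq lift_inj).
Qed.

Lemma min_class_size_mul (F : sgraph) k :
  chi F = k -> (k * min_class_size F <= #|F|)%N.
Proof.
move=> Fk; have [c pc] := chi_colouring F; rewrite Fk in c pc.
have -> : #|F| = (\sum_(i < k) class_size c i)%N.
  rewrite -sum1_card (partition_big c xpredT) //=; apply: eq_bigr => i _.
  by rewrite sum1_card /class_size cardsE; apply: eq_card.
rewrite -[k in leqLHS]card_ord -sum_nat_const; apply: leq_sum => i _.
exact: min_class_size_leq.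
Qed.

(** A homomorphism pulls the parts back to a colouring of [F] with [chi F] colours, so it puts at
    least [min_class_size F] of its [#|F|] vertices into part 0. Nonnegative weights pass this
    proportion on to the whole graph. *)
Lemma multipartite_not_Spa (R : realType) (F : sgraph) k (m : 'I_k.+1 -> nat) :
  chi F = k.+1 -> (m 0%R * #|F| < min_class_size F * #|multipartite m|)%N ->
  ~ Spa R F (multipartite m).
Proof.
move=> Fk + [w wP w01]; rewrite ltnNge => /negP; apply.
have E0 := perfect_tiling_sum (fun v : multipartite m => (tag v == 0)%:R) wP.
have E1 : #|multipartite m|%:R = \sum_phi w phi * #|F|%:R.
  have := perfect_tiling_sum (fun=> 1) wP; rewrite sumr_const => ->.
  by apply: eq_bigr => phi _; rewrite sumr_const.
rewrite -natr_card card_multipartite_part in E0.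
rewrite -(ler_nat R) !natrM E0 E1 mulr_suml mulr_sumr.
apply: ler_sum => phi _; have /andP[w0 _] := w01 phi.
rewrite mulrC [leRHS]mulrAC ler_wpM2l ?mulr_ge0 // -natr_card ler_nat.
have /(min_class_size_leq 0 Fk) := multipartite_colouring phi.
congr (_ <= _)%N; apply: eq_card => u; rewrite !inE ffunE; exact: val_eqE.
Qed.

(** * Thresholds *)

Lemma threshold_eq (R : realType) (m : nat) (X : sgraph -> Prop) (d : R) :
  0 <= d <= 1 -> degree_forces m X d ->
  (forall t, (0 < t)%N -> exists G : sgraph, [/\ (t <= #|G|)%N, (m %| #|G|)%N,
     d * #|G|%:R - 1 <= (min_degree G)%:R & ~ X G]) ->
  threshold R m X = d.
Proof.
move=> d01 Xd nX; apply/eqP; rewrite eq_le; apply/andP; split.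
  by apply: ge_inf => //; exists 0 => x [/andP[]].
apply: lb_le_inf; first by exists d.
move=> x [/andP[x0 _] Xx]; rewrite leNgt; apply/negP => xd.
(* Half of the gap serves as [mu]; the other half absorbs the constant lost in [d n - 1] once
   [mu n > 1]. *)
pose mu := (d - x) / 2; have mu0 : 0 < mu by rewrite divr_gt0 // subr_gt0.
have [n0 Hn0] := Xx mu mu0.
have [G [tG mG dG]] := nX (maxn n0 (Num.bound mu^-1)).+1 isT.
apply; apply: (Hn0 #|G|) => //; first by apply: leq_trans tG; rewrite leqW ?leq_maxl.
apply: le_trans dG.
have : mu^-1 < #|G|%:R.
  apply: lt_le_trans (archi_boundP _) _; first by rewrite invr_ge0 ltW.
  by rewrite ler_nat; apply: leq_trans tG; rewrite leqW ?leq_maxr.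
rewrite -div1r ltr_pdivrMr //; move: (#|G|%:R) => n.
have -> : d = x + 2 * mu by rewrite /mu; field.
nra.
Qed.

(** [d] is general because this is applied at both threshold values. *)
Lemma degree_joined (R : realType) k (d mu : R) :
  1 - 1 / k.+1%:R <= d -> d <= 1 -> 0 < mu ->
  exists n0 : nat, forall G : sgraph, (n0 <= #|G|)%N ->
    (d + mu) * (#|G|%:R - 1) <= (min_degree G)%:R ->
    joined k.+2 G 2 /\ (#|G| - min_degree G)%:R <= (1 - d) * #|G|%:R.
Proof.
move=> dk d1 mu0; exists (Num.bound (2 / mu)).+1 => G Gn dG.
have mindeg_le : (min_degree G <= #|G|)%N.
  have [v _] : exists v : G, v \in predT by apply/card_gt0P/(leq_ltn_trans _ Gn).
  exact: leq_trans (min_degree_leq v) (max_card _).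
(* This slack pays for the two common neighbours and for n - 1 in place of n. *)
have n2 : 2 <= mu * (#|G|%:R - 1).
  rewrite mulrC -ler_pdivrMr // lerBrDr.
  apply: le_trans (_ : (Num.bound (2 / mu)).+1%:R <= _); last by rewrite ler_nat.
  by rewrite -[leRHS]natr1 lerD2r ltW // archi_boundP // divr_ge0 // ltW.
have n1 : 1 <= #|G|%:R :> R by rewrite ler1n (leq_ltn_trans _ Gn).
have codegE : (#|G| - min_degree G)%:R = #|G|%:R - (min_degree G)%:R :> R.
  exact: natrB.
split; last by rewrite codegE; lra.
move=> s sk; apply: card_common_neighbours.
apply: leq_trans (_ : 2 + k.+1 * (#|G| - min_degree G) <= _)%N.
  by rewrite leq_add2l leq_mul2r -ltnS sk orbT.
rewrite -(ler_nat R) natrD natrM codegE.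
have k1 : 1 <= k.+1%:R :> R by rewrite ler1n.
have kd : k.+1%:R - 1 <= k.+1%:R * d.
  have -> : k.+1%:R - 1 = k.+1%:R * (1 - 1 / k.+1%:R) :> R.
    by field; rewrite addrC natr1 pnatr_eq0.
  by rewrite ler_wpM2l.
have := ler_wpM2l (ler0n R k.+1) dG.
have : (k.+1%:R - 1) * (#|G|%:R - 1) <= k.+1%:R * d * (#|G|%:R - 1).
  by rewrite ler_wpM2r // subr_ge0.
have : k.+1%:R * 2 <= k.+1%:R * (mu * (#|G|%:R - 1)) by rewrite ler_wpM2l.
lra.
Qed.

(** * Extremal graphs *)

(** A homomorphism would colour [F] with k + 1 colours. Parts of size |F| t keep the order divisible
    by |F|. *)
Lemma complete_balanced (F : sgraph) k t : chi F = k.+2 -> (0 < #|F|)%N -> (0 < t)%N ->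
  exists G : sgraph, [/\ #|G| = (k.+1 * (#|F| * t))%N,
    (k * (#|F| * t) <= min_degree G)%N & graph_hom F G -> False].
Proof.
move=> Fk F0 t0; pose G := multipartite (fun _ : 'I_k.+1 => #|F| * t)%N.
have cG : #|G| = (k.+1 * (#|F| * t))%N.
  by rewrite card_multipartite sum_nat_const card_ord.
exists G; split=> //; last first.
  by move=> phi; have /chi_leq := multipartite_colouring phi; rewrite Fk ltnn.
have := @min_degree_multipartite _ (fun _ : 'I_k.+1 => #|F| * t)%N (#|F| * t)%N.
by rewrite -/G cG mulSn addKn; apply.
Qed.

(** Shared by [Div] and [Cov]: both follow from [joined], and both fail on a nonempty graph without
    homomorphisms from [F]. *)
Lemma threshold_eq_chi (R : realType) (F : sgraph) k (X : sgraph -> Prop) :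
  chi F = k.+2 -> (0 < #|F|)%N ->
  (forall G : sgraph, (#|F| %| #|G|)%N -> joined k.+2 G 2 -> X G) ->
  (forall G : sgraph, (0 < #|G|)%N -> (graph_hom F G -> False) -> ~ X G) ->
  threshold R #|F| X = 1 - 1 / ((chi F)%:R - 1).
Proof.
move=> Fk F0 XG nX; have -> : (chi F)%:R - 1 = k.+1%:R :> R by rewrite Fk -natr1 addrK.
have k0 : 0 < k.+1%:R :> R by rewrite ltr0n.
have d1 : 1 / k.+1%:R <= 1 :> R by rewrite ler_pdivrMr // mul1r ler1n.
apply: threshold_eq.
- by rewrite subr_ge0 d1 gerBl divr_ge0 // ltW.
- move=> mu mu0.
  have [|n0 Hn0] := @degree_joined R k (1 - 1 / k.+1%:R) mu (lexx _) _ mu0.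
    by rewrite gerBl divr_ge0 // ltW.
  exists n0 => n n0n Fn G Gn; rewrite -Gn => dG.
  by apply: XG; rewrite ?Gn //; have [|] := Hn0 G _ dG; rewrite ?Gn.
move=> t t0; have [G [cG dG nohom]] := complete_balanced Fk F0 t0; exists G.
have Gt0 : (0 < #|G|)%N by rewrite cG !muln_gt0 F0.
split; rewrite ?cG; last exact: nX.
- by rewrite mulnA leq_pmull // muln_gt0.
- by rewrite mulnCA dvdn_mulr.
apply: le_trans (_ : (k * (#|F| * t))%:R <= _); last by rewrite ler_nat.
rewrite [(k * _)%:R]natrM [(k.+1 * _)%:R]natrM mulrBl !mul1r mulrA.
by rewrite mulVf ?gt_eqF // -natr1 mulrDl addrK gerBl ler01.
Qed.

(* The exceptional part has (k + 1)(st - 1) vertices, just below the fraction s/|F|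
   of all (k + 1)|F|t vertices. *)
Lemma bottle_not_Spa (R : realType) (F : sgraph) k t (s := min_class_size F) :
  chi F = k.+2 -> (0 < t)%N ->
  exists G : sgraph, [/\ #|G| = (k.+1 * #|F| * t)%N,
    (#|G| - ((#|F| - s) * t + 1) <= min_degree G)%N & ~ Spa R F G].
Proof.
move=> Fk t0; have s0 : (0 < s)%N := min_class_size_gt0 Fk.
have sF : (k.+2 * s <= #|F|)%N := min_class_size_mul Fk.
(* The corrections - 1 and + 1 cancel over all parts, so the order is exactly (k + 1) |F| t. *)
pose m (i : 'I_k.+2) := if i == 0 then (k.+1 * (s * t - 1))%N else ((#|F| - s) * t + 1)%N.
have st0 : (0 < s * t)%N by rewrite muln_gt0 s0.
have sFt : (s * t <= #|F| * t)%N by rewrite leq_mul2r (leq_trans _ sF) ?orbT // leq_pmull.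
have cG : #|multipartite m| = (k.+1 * #|F| * t)%N.
  have mS (i : 'I_k.+1) : m (lift ord0 i) = ((#|F| - s) * t + 1)%N.
    by rewrite /m eq_sym (negPf (neq_lift _ _)).
  rewrite card_multipartite big_ord_recl (eq_bigr _ (fun i _ => mS i)) /m eqxx.
  rewrite sum_nat_const card_ord -mulnDr -mulnA; congr (_ * _)%N.
  by rewrite mulnBl; lia.
exists (multipartite m); split=> //.
  (* Part 0 is no larger than the others since (k + 2) s <= |F|. *)
  apply: min_degree_multipartite => i; rewrite /m; case: ifP => // _.
  nia.
apply: multipartite_not_Spa Fk _; rewrite cG /m eqxx -/s; nia.
Qed.

(** * The three thresholds *)

Theorem proposition4p5 (R : realType) (F : sgraph)
    (hgcd : gcd_graph F = Some 1%N) (hchi : (3 <= chi F)%N) :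
  [/\ threshold R #|F| (Spa R F) = 1 - 1 / chi_cr F R,
      threshold R #|F| (Div R F) = 1 - 1 / ((chi F)%:R - 1)
    & threshold R #|F| (Cov F) = 1 - 1 / ((chi F)%:R - 1)].
Proof.
have [k Fk] : exists k, chi F = k.+3 by exists (chi F - 3)%N; rewrite -addn3 subnK.
have s0 := min_class_size_gt0 Fk; have sF := min_class_size_mul Fk.
have F0 : (0 < #|F|)%N by apply: leq_trans sF; rewrite muln_gt0.
have joinedW (G : sgraph) : joined k.+3 G 2 -> joined k.+3 G 1.
  by move=> jG s /jG; apply: leq_trans.
split.
- have -> : 1 - 1 / chi_cr F R = 1 - (1 - tau F R) / k.+2%:R.
    by rewrite /chi_cr Fk -natr1 addrK div1r invf_div.
  have F0R : 0 < #|F|%:R :> R by rewrite ltr0n.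
  have k0 : 0 < k.+2%:R :> R by rewrite ltr0n.
  have tau0 : 0 <= tau F R by rewrite divr_ge0.
  have tau1 : tau F R <= 1.
    by rewrite ler_pdivrMr // mul1r ler_nat (leq_trans _ sF) // leq_pmull.
  have sg0 : 0 <= (1 - tau F R) / k.+2%:R by rewrite divr_ge0 ?subr_ge0 // ltW.
  have sg1 : (1 - tau F R) / k.+2%:R <= 1 / k.+2%:R.
    by rewrite ler_pM2r ?invr_gt0 // gerBl.
  have kk : 1 / k.+2%:R <= 1 :> R by rewrite ler_pdivrMr // mul1r ler1n.
  (* For D = (1 - tau) n / (k + 2) the condition of [Spa_joined] is an equality. *)
  have sgE n : k.+2%:R * #|F|%:R * ((1 - tau F R) / k.+2%:R * n) =
      (#|F|%:R - (min_class_size F)%:R) * n.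
    rewrite /tau; move: (k.+2%:R) (#|F|%:R) k0 F0R => a b a0 b0.
    by field; rewrite !gt_eqF.
  apply: threshold_eq.
  + by rewrite subr_ge0 gerBl sg0 (le_trans sg1).
  (* As tau >= 0, the fractional threshold is at least 1 - 1 / (k + 2), as [degree_joined]
     requires. *)
  + move=> mu mu0; have [||n0 Hn0] := @degree_joined R k.+1
        (1 - (1 - tau F R) / k.+2%:R) mu _ _ mu0.
    * by rewrite lerD2l lerN2.
    * by rewrite gerBl.
    exists n0 => n n0n Fn G Gn; rewrite -Gn => dG.
    have [|jG] := Hn0 G _ dG; first by rewrite Gn.
    rewrite subKr => codeg; apply: (Spa_joined (D := (#|G| - min_degree G)%:R) Fk
      (joinedW _ jG) _ _ F0).
      by move=> v; rewrite ler_nat; apply: card_nonneighbours.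
    apply: le_trans (ler_wpM2l _ codeg) _; first by rewrite mulr_ge0.
    by rewrite sgE.
  move=> t t0; have [G [cG dG nS]] := bottle_not_Spa R Fk t0; exists G; split=> //.
  + by rewrite cG leq_pmull // muln_gt0.
  + by rewrite cG mulnAC dvdn_mull.
  apply: le_trans (_ : (#|G| - ((#|F| - min_class_size F) * t + 1))%:R <= _);
    last by rewrite ler_nat.
  have sF' : (min_class_size F <= #|F|)%N by rewrite (leq_trans _ sF) // leq_pmull.
  rewrite natrB; last by rewrite cG; nia.
  rewrite natrD natrM natrB // opprD addrA lerD2r mulrBl mul1r lerD2l lerN2.
  by rewrite cG !natrM [leRHS]mulrCA sgE.
- apply: (threshold_eq_chi _ Fk F0) => [G FG jG|G G0 nohom [w wP _]].
    have [x0] := joined_neighbour (s := [::]) (joinedW _ jG) isT.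
    by move=> _; apply: (Div_joined R x0 Fk hgcd FG); apply: joinedW.
  exact: no_hom_not_tiled nohom G0 wP.
apply: (threshold_eq_chi _ Fk F0) => [G _|G G0 nohom CG].
  have [u0 _] : exists u : F, u \in predT by apply/card_gt0P.
  exact: Cov_joined.
by have [v _] : exists v : G, v \in predT by [apply/card_gt0P]; case: (CG v).
Qed.
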